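(* Let $C$ be a linear code of length $n$ over $\mathbb{F}_q$. Let $\mathbf{v}=(v_1,\dots,v_\ell)$ with $\sum_{i=1}^{\ell}v_i=n$, and let $X_1,\dots,X_\ell$ be mutually disjoint subsets of $[n]$ with $X_1\sqcup\cdots\sqcup X_\ell=[n]$ and $|X_i|=v_i$ for all $i$. Let $1\le k\le\ell$ (with $X_k\neq\emptyset$). Then: (1) For every coordinate place $i\in X_k$, $$\mathrm{SCJ}_{C,X_1(\emptyset),\dots,X_{k-1}(\emptyset),X_k(\{i\}),X_{k+1}(\emptyset),\dots,X_\ell(\emptyset)}=x_{X_k,0}\,\mathbf{scwe}_{C/i,X_1,\dots,X_k\setminus\{i\},\dots,X_\ell}+\sum_{a\in\mathbb{F}_q,\,a\ne0}x_{X_k,a}\,\mathbf{scwe}_{C+i_a,X_1,\dots,X_k\setminus\{i\},\dots,X_\ell}.$$ (2) If $C$ contains no nonzero codewords of Hamming weight less than $1$, then $$v_k\,\big(A_{2q\ell,k}\cdot\mathbf{scwe}_{C,X_1,\dots,X_\ell}\big)=x_{X_k,0}\sum_{i\in X_k}\mathbf{scwe}_{C/i,X_1,\dots,X_k\setminus\{i\},\dots,X_\ell}+\sum_{a\in\mathbb{F}_q,\,a\neq0}x_{X_k,a}\sum_{i\in X_k}\mathbf{scwe}_{C+i_a,X_1,\dots,X_k\setminus\{i\},\dots,X_\ell}.$$ (3) If $C$ is a generalized colorwise homogeneous code (with respect to $X_1,\dots,X_\ell$), then for every $i\in X_k$, $$\mathrm{SCJ}_{C,X_1(\emptyset),\dots,X_{k-1}(\emptyset),X_k(\{i\}),X_{k+1}(\emptyset),\dots,X_\ell(\emptyset)}=A_{2q\ell,k}\cdot\mathbf{scwe}_{C,X_1,\dots,X_\ell}.$$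 In all three formulas the split complete weight enumerators $\mathbf{scwe}$ are written in the variables $y_{X_j,a}$.
   Context: $[n]=\{1,\dots,n\}$. A linear code of length $n$ over $\mathbb{F}_q$ is a vector subspace of $\mathbb{F}_q^n$. The Hamming weight of a vector is its number of nonzero coordinates. For $X\subseteq[n]$, $a\in\mathbb{F}_q$ and a vector $\mathbf{u}$ put $n_{a,X}(\mathbf{u})=\#\{i\in X\mid u_i=a\}$. Variables: commuting variables $x_{X_j,a},y_{X_j,a}$ for $1\le j\le\ell$, $a\in\mathbb{F}_q$ (labelled by the original index $j$ of the part, also when $X_k$ is replaced by $X_k\setminus\{i\}$). Split complete Jacobi polynomial, for $T_j\subseteq X_j$: $\mathrm{SCJ}_{C,X_1(T_1),\dots,X_\ell(T_\ell)}=\sum_{\mathbf{u}\in C}\prod_{j=1}^{\ell}\prod_{a\in\mathbb{F}_q}x_{X_j,a}^{\,n_{a,T_j}(\mathbf{u})}y_{X_j,a}^{\,n_{a,X_j\setminus T_j}(\mathbf{u})}$. Split complete weight enumerator: for a set $D$ of vectors whose coordinate set is partitioned as $Y_1\sqcup\cdots\sqcup Y_\ell$, written in the $y$-variables, $\mathbf{scwe}_{D,Y_1,\dots,Y_\ell}=\sum_{\mathbf{u}\in D}\prod_{j=1}^{\ell}\prod_{a\in\mathbb{F}_q}y_{X_j,a}^{\,n_{a,Y_j}(\mathbf{u})}$. Puncturing at $i$ means deleting the $i$-th coordinate, so that the remaining coordinates are indexed by $[n]\setminus\{i\}$. $C/i$ denotes $C$ shortened at $i$: the codewords with $i$-th entry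 $0$, punctured at $i$. For $a\in\mathbb{F}_q$, $C+i_a$ denotes the set of codewords of $C$ with $i$-th entry equal to $a$, punctured at $i$. Polarization operator: for a polynomial $P$ of degree $n$ in the variables $x_{X_j,a},y_{X_j,a}$ such that in each term the total power of the variables $x_{X_j,a},y_{X_j,a}$ ($a\in\mathbb{F}_q$) is $v_j$ for every $j$, $A_{2q\ell,k}\cdot P=\frac{1}{v_k}\sum_{a\in\mathbb{F}_q}x_{X_k,a}\,\frac{\partial P}{\partial y_{X_k,a}}$ (where $v_k\geq 1$). Generalized colorwise homogeneous: a split composition is a tuple $\mathbf{s}=(s_1,\dots,s_\ell)$ with each $s_j=(s_{j,a})_{a\in\mathbb{F}_q}$ a tuple of non-negative integers with sum $v_j$; $C_{\mathbf{s}}$ is the set of $\mathbf{u}\in C$ with $n_{a,X_j}(\mathbf{u})=s_{j,a}$ for all $j,a$. $C$ is generalized colorwise $t$-homogeneous if for every $\mathbf{s}$ the set $C_{\mathbf{s}}$ is a generalized colored $t$-design, with color set $\mathbb{F}_q$ and the codeword $\mathbf{u}$ giving color $u_p$ to the coordinate $p$: for every tuple $(t_1,\dots,t_\ell)$ of non-negative integers with $\sum_jt_j=t$ and all multisets $P_j$ of $t_j$ elements of $\mathbb{F}_q$ ($1\le j\le \ell$) there is $\lambda\ge0$ such that for every choice of $t_j$-subsets $T_j\subseteq X_j$ there are exactly $\lambda$ codewords $\mathbf{u}\in C_{\mathbf{s}}$ for which the multiset $\{u_p:p\in T_j\}$ equals $P_j$ for all $j$. Generalized colorwise homogeneous means generalized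 colorwise $1$-homogeneous. *)

(* Defs.v *)
From HB Require Import structures.
From mathcomp Require Import all_boot all_order all_algebra.
From mathcomp Require Import finmap multiset mpoly.

Set Implicit Arguments.
Unset Strict Implicit.
Unset Printing Implicit Defensive.

Import GRing.Theory.

Local Open Scope mset_scope.
Local Open Scope ring_scope.

(* F_q^n.  The regular module [F^o] (convertible to [F]) is what gives
   [{ffun 'I_n -> F^o}] its vector space structure over [F]. *)
Notation linear_code n F := {vspace {ffun 'I_n -> F^o}}.

Definition codewords (F : finFieldType) (n : nat) (C : linear_code n F) :
    {set {ffun 'I_n -> F}} :=
  [set u : {ffun 'I_n -> F} | (u : {ffun 'I_n -> F^o}) \in C].

Definition hamming_weight (F : finFieldType) (I : finType)
    (u : {ffun I -> F}) : nat :=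
  #|[set p | u p != 0]|.

Definition ncoord (F : finFieldType) (I : finType) (a : F) (X : {set I})
    (u : {ffun I -> F}) : nat :=
  #|[set p in X | u p == a]|.

(* The 2ql variables x_{j,a}, y_{j,a}.  Since [mpoly] indexes variables by
   ordinals, they are numbered through [enum_rank], with [inl (j, a)] for
   x_{j,a} and [inr (j, a)] for y_{j,a}.  The coefficients are rational because
   the polarization operator divides by v_k. *)
Definition split_var (F : finFieldType) (l : nat) : finType :=
  (('I_l * F) + ('I_l * F))%type.

Definition split_poly (F : finFieldType) (l : nat) :=
  {mpoly rat[#|split_var F l|]}.

Definition xidx (F : finFieldType) (l : nat) (j : 'I_l) (a : F) :
    'I_#|split_var F l| :=
  enum_rank (inl (j, a) : split_var F l).

Definition yidx (F : finFieldType) (l : nat) (j : 'I_l) (a : F) :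
    'I_#|split_var F l| :=
  enum_rank (inr (j, a) : split_var F l).

Definition xvar (F : finFieldType) (l : nat) (j : 'I_l) (a : F) :
  split_poly F l := 'X_(xidx j a).

Definition yvar (F : finFieldType) (l : nat) (j : 'I_l) (a : F) :
  split_poly F l := 'X_(yidx j a).

Definition SCJ (F : finFieldType) (l : nat) (I : finType)
    (D : {set {ffun I -> F}}) (X T : 'I_l -> {set I}) : split_poly F l :=
  \sum_(u in D) \prod_(j < l) \prod_(a : F)
    (xvar j a ^+ ncoord a (T j) u * yvar j a ^+ ncoord a (X j :\: T j) u).

Definition scwe (F : finFieldType) (l : nat) (I : finType)
    (D : {set {ffun I -> F}}) (Y : 'I_l -> {set I}) : split_poly F l :=
  \sum_(u in D) \prod_(j < l) \prod_(a : F) yvar j a ^+ ncoord a (Y j) u.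

(* The family (set0, ..., {i}, ..., set0) with {i} at place k. *)
Definition single_at (l : nat) (I : finType) (k : 'I_l) (i : I) :
    'I_l -> {set I} :=
  fun j => if j == k then [set i] else set0.

Definition puncture (F : finFieldType) (I : finType) (i : I)
    (u : {ffun I -> F}) : {ffun {p : I | p != i} -> F} :=
  [ffun p => u (val p)].

(* C + i_a *)
Definition code_at (F : finFieldType) (I : finType) (D : {set {ffun I -> F}})
    (i : I) (a : F) : {set {ffun {p : I | p != i} -> F}} :=
  [set puncture i u | u in D & u i == a].

(* C / i *)
Definition code_shorten (F : finFieldType) (I : finType) (D : {set {ffun I -> F}})
    (i : I) : {set {ffun {p : I | p != i} -> F}} :=
  [set puncture i u | u in D & u i == 0].

(* The parts [X j :\ i], seen as subsets of the coordinate set deprived of [i].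
   When the [X j] are disjoint and [i] is in [X k], only the k-th changes. *)
Definition delete_parts (l : nat) (I : finType) (X : 'I_l -> {set I}) (i : I) :
    'I_l -> {set {p : I | p != i}} :=
  fun j => [set p | val p \in X j].

(* A_{2ql,k}, for polynomials all of whose terms have total degree v_j in the
   variables x_{j,a}, y_{j,a} (a in F), for every j. *)
Definition polarize (F : finFieldType) (l : nat) (v : 'I_l -> nat) (k : 'I_l)
    (P : split_poly F l) : split_poly F l :=
  (v k)%:R^-1 *: \sum_(a : F) xvar k a * P^`M(yidx k a).

Definition composition_class (F : finFieldType) (l : nat) (I : finType)
    (D : {set {ffun I -> F}}) (X : 'I_l -> {set I}) (s : 'I_l -> F -> nat) :
    {set {ffun I -> F}} :=
  [set u in D | [forall j, forall a, ncoord a (X j) u == s j a]].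

Definition colors_on (F : finFieldType) (I : finType) (u : {ffun I -> F})
    (T : {set I}) : {mset F} :=
  seq_mset [seq u p | p in T].

Definition generalized_colored_design (t : nat) (F : finFieldType) (l : nat)
    (I : finType) (D : {set {ffun I -> F}}) (X : 'I_l -> {set I}) : Prop :=
  forall (tt : 'I_l -> nat) (P : 'I_l -> {mset F}),
    (\sum_(j < l) tt j = t)%N ->
    (forall j, size (P j) = tt j) ->
    exists lambda : nat,
      forall T : 'I_l -> {set I},
        (forall j, T j \subset X j /\ #|T j| = tt j) ->
        #|[set u in D | [forall j, colors_on u (T j) == P j]]| = lambda.

Definition generalized_colorwise_homogeneous (t : nat) (F : finFieldType) (l : nat)
    (I : finType) (D : {set {ffun I -> F}}) (X : 'I_l -> {set I}) : Prop :=
  forall s : 'I_l -> F -> nat,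
    (forall j, \sum_(a : F) s j a = #|X j|)%N ->
    generalized_colored_design t (composition_class D X s) X.

(* Main.v *)
(* In the Jacobi polynomial with T_k = {i}, a codeword u contributes x_{k,u_i}
   times the monomial of u with i deleted; sorting codewords by u_i gives (1).
   The operator sum_a x_{k,a} d/dy_{k,a} is a derivation sending y_{j,b} to
   x_{k,b} if j = k and to 0 otherwise, so by Leibniz it sends scwe to the sum
   over i in X_k of these Jacobi polynomials, which is (2).  If C is colorwise
   homogeneous these Jacobi polynomials do not depend on i, and (3) follows on
   dividing by v_k. *)
Require Import Defs.
From HB Require Import structures.
From mathcomp Require Import all_boot all_order all_algebra.
From mathcomp Require Import finmap multiset mpoly.

Set Implicit Arguments.
Unset Strict Implicit.
Unset Printing Implicit Defensive.

Import GRing.Theory.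

Local Open Scope ring_scope.

(** * The Leibniz rule over finite products *)

Section Derivation.
Variables (R : comNzRingType) (D : {additive R -> R}).
Hypothesis DM : forall p q, D (p * q) = D p * q + p * D q.

Lemma derivation1 : D 1 = 0.
Proof.
have := DM 1 1; rewrite !mul1r mulr1 => /eqP.
by rewrite -subr_eq0 opprD addNKr oppr_eq0 => /eqP.
Qed.

Lemma derivation_prod (T : finType) (A : {set T}) (f : T -> R) :
  D (\prod_(i in A) f i) = \sum_(i in A) D (f i) * \prod_(j in A :\ i) f j.
Proof.
have [m] := ubnP #|A|; elim: m A => // m IHm A; rewrite ltnS => leAm.
have [->|[i Ai]] := set_0Vmem A; first by rewrite !big_set0 derivation1.
rewrite (big_setD1 i Ai) DM IHm /=; last first.
  by move: leAm; rewrite (cardsD1 i A) Ai.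
rewrite [RHS](big_setD1 i Ai) /= mulr_sumr; congr (_ + _).
apply: eq_bigr => j /setD1P[neq_ji Aj].
(* [i] survives the removal of [j], so [f i] factors out of every remaining term. *)
have Aij : i \in A :\ j by rewrite !inE eq_sym neq_ji.
rewrite (big_setD1 i Aij) /= mulrCA; congr (_ * (_ * _)).
by apply: eq_bigl => p; rewrite !inE andbCA.
Qed.

End Derivation.

(** * The polarization operator as a derivation *)

Section Polarization.
Variables (F : finFieldType) (l : nat) (k : 'I_l).

(** This is v_k A_{2ql,k}, the operator of formula (2); once it is registered as additive,
    [derivation_prod] applies to it. *)
Definition unnormalized_polarize (P : split_poly F l) : split_poly F l :=
  \sum_(a : F) xvar k a * P^`M(yidx k a).

Fact unnormalized_polarize_is_zmod_morphism :
  zmod_morphism unnormalized_polarize.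
Proof.
move=> P Q; rewrite /unnormalized_polarize -sumrB.
by apply: eq_bigr => a _; rewrite mderivB mulrBr.
Qed.

HB.instance Definition _ :=
  Algebra.isZmodMorphism.Build (split_poly F l) (split_poly F l)
    unnormalized_polarize unnormalized_polarize_is_zmod_morphism.

Lemma unnormalized_polarizeM P Q :
  unnormalized_polarize (P * Q)
  = unnormalized_polarize P * Q + P * unnormalized_polarize Q.
Proof.
rewrite /unnormalized_polarize mulr_suml mulr_sumr -big_split /=.
by apply: eq_bigr => a _; rewrite mderivM mulrDr !mulrA [P * _]mulrC.
Qed.

Lemma unnormalized_polarize_yvar j b :
  unnormalized_polarize (yvar j b) = if j == k then xvar k b else 0.
Proof.
have dE a : (yvar j b)^`M(yidx k a) = ((j == k) && (b == a))%:R :> split_poly F l.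
  rewrite /yvar mderivX mnm1E (inj_eq enum_rank_inj).
  have -> : (inr (j, b) == inr (k, a) :> split_var F l) = (j == k) && (b == a).
    by [].
  case: andP => [[/eqP-> /eqP->]|_]; last by rewrite scale0r.
  by rewrite scale1r -[X in (X - _)%MM]add0m addmK mpolyX0.
rewrite /unnormalized_polarize (eq_bigr _ (fun a _ => congr1 _ (dE a))).
case: eqP => _ /=; last by rewrite big1 // => a _; rewrite mulr0.
rewrite (bigD1 b) //= eqxx mulr1 big1 ?addr0 // => a /negPf.
by rewrite eq_sym => ->; rewrite mulr0.
Qed.

End Polarization.

(** Sorting the coordinates in [A] by their color turns exponents into one factor per coordinate,
    the form on which the Leibniz rule acts. *)
Lemma prod_ncoord (F : finFieldType) (I : finType) (R : comNzRingType)
    (f : F -> R) (A : {set I}) (u : {ffun I -> F}) :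
  \prod_(a : F) f a ^+ ncoord a A u = \prod_(p in A) f (u p).
Proof.
rewrite [RHS](partition_big u xpredT) //=; apply: eq_bigr => a _.
rewrite -prodr_const; under [RHS]eq_bigr => p /andP[_ /eqP->] do [].
by apply: eq_bigl => p; rewrite inE.
Qed.

(** * Enumerators of punctured codes and Jacobi polynomials with one marked coordinate *)

Section Enumerators.
Variables (F : finFieldType) (l : nat) (I : finType).
Implicit Types (D : {set {ffun I -> F}}) (u : {ffun I -> F}).
Implicit Types (X : 'I_l -> {set I}) (s : 'I_l -> F -> nat).

Lemma sum_ncoord (A : {set I}) u : (\sum_(a : F) ncoord a A u = #|A|)%N.
Proof.
rewrite -sum1_card [RHS](partition_big u xpredT) //=; apply: eq_bigr => a _.
by rewrite sum1dep_card; apply: eq_card => p; rewrite !inE.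
Qed.

(** The truncated subtraction is exact: as [i] lies in [A], the count is at least 1 whenever [u i]
    is [a]. *)
Lemma ncoordD1 a (A : {set I}) i u : i \in A ->
  ncoord a (A :\ i) u = (ncoord a A u - (u i == a))%N.
Proof.
move=> Ai; rewrite /ncoord (cardsD1 i [set p in A | u p == a]) inE Ai /= addKn.
by apply: eq_card => p; rewrite !inE andbA.
Qed.

Definition deleted_monomial X i u : split_poly F l :=
  \prod_(j < l) \prod_(p in X j :\ i) yvar j (u p).

(** Puncturing at [i] is injective on words with a fixed entry there, so no two codewords merge in
    [code_at]. *)
Lemma scwe_code_at D X i a :
  scwe (code_at D i a) (delete_parts X i)
  = \sum_(u in D | u i == a) deleted_monomial X i u.
Proof.
rewrite /scwe /code_at.
under eq_bigr do under eq_bigr do rewrite prod_ncoord.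
rewrite big_imset /=; last first.
  move=> u w /[!inE] /andP[_ /eqP ua] /andP[_ /eqP wa] /ffunP eq_uw.
  apply/ffunP => p; have [->|neq_pi] := eqVneq p i; first by rewrite ua wa.
  by have := eq_uw (exist _ p neq_pi); rewrite !ffunE.
apply: eq_big => [u|u _]; first by rewrite inE.
apply: eq_bigr => j _; under eq_bigr do rewrite ffunE.
rewrite [RHS](reindex_omap val (insub : I -> option {p : I | p != i})) /=.
  apply: eq_bigl => p; rewrite !inE valK eqxx andbT.
  by rewrite (valP p).
by move=> p /setD1P[neq_pi _]; rewrite insubT.
Qed.

Section Disjoint.
Variables (X : 'I_l -> {set I}) (k : 'I_l).
Hypothesis hdisj : forall j j' : 'I_l, j != j' -> [disjoint X j & X j'].

Lemma setD_single_at i j : i \in X k -> X j :\: single_at k i j = X j :\ i.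
Proof.
move=> Xki; rewrite /single_at; case: eqP => // /eqP neq_jk.
rewrite setD0; apply/esym/setDidPl; rewrite disjoint_sym disjoints1.
by rewrite (disjointFl (hdisj neq_jk)).
Qed.

Lemma SCJ_single_at D i : i \in X k ->
  SCJ D X (single_at k i) = \sum_(u in D) xvar k (u i) * deleted_monomial X i u.
Proof.
move=> Xki; apply: eq_bigr => u _.
under eq_bigr do rewrite big_split /= !prod_ncoord setD_single_at //.
rewrite big_split /=; congr (_ * _).
rewrite (bigD1 k) //= /single_at eqxx big_set1 big1 ?mulr1 // => j /negPf->.
by rewrite big_set0.
Qed.

Lemma SCJ_single_atE D i : i \in X k ->
  SCJ D X (single_at k i)
  = \sum_(a : F) xvar k a * scwe (code_at D i a) (delete_parts X i).
Proof.
move=> Xki; rewrite SCJ_single_at // (partition_big (fun u => u i) xpredT) //=.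
apply: eq_bigr => a _; rewrite scwe_code_at mulr_sumr.
by apply: eq_bigr => u /andP[_ /eqP->].
Qed.

Lemma unnormalized_polarize_scwe D :
  unnormalized_polarize k (scwe D X) = \sum_(i in X k) SCJ D X (single_at k i).
Proof.
rewrite /scwe raddf_sum (eq_bigr _ (fun i => @SCJ_single_at D i)) [RHS]exchange_big.
apply: eq_bigr => u _ /=.
under eq_bigr do rewrite prod_ncoord.
(* The double product becomes a single one over pairs (part, coordinate), as [derivation_prod]
   requires. *)
rewrite pair_big_dep /=.
pose A := [set q : 'I_l * I | q.2 \in X q.1].
rewrite (eq_bigl (fun q => q \in A)) => [|q]; last by rewrite inE.
rewrite derivation_prod /=; last exact: unnormalized_polarizeM.
under eq_bigr do rewrite unnormalized_polarize_yvar.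
transitivity (\sum_(j < l) \sum_(p in X j) (if j == k then xvar k (u p) else 0) *
    \prod_(q in A :\ (j, p)) yvar q.1 (u q.2)).
  by rewrite pair_big_dep; apply: eq_big => -[j p] //=; rewrite inE.
rewrite (bigD1 k) //= [X in _ + X]big1 ?addr0 => [|j /negPf neq_jk]; last first.
  by apply: big1 => p _; rewrite neq_jk mul0r.
apply: eq_bigr => i Xki; rewrite eqxx; congr (_ * _).
(* Removing the pair (k, i) from [A] amounts to removing [i] from every part, since disjointness
   keeps [i] out of the parts other than [X k]. *)
rewrite /deleted_monomial pair_big_dep /=; apply: eq_bigl => -[j p].
rewrite !inE /= xpair_eqE; case: (eqVneq p i) => [->|]; rewrite ?andbF ?andbT //.
case: (eqVneq j k) => //= neq_jk.
by rewrite (disjointFl (hdisj neq_jk)).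
Qed.

Lemma homogeneous_card D s i i' c :
  generalized_colorwise_homogeneous 1 D X -> i \in X k -> i' \in X k ->
  #|[set u in composition_class D X s | u i == c]|
  = #|[set u in composition_class D X s | u i' == c]|.
Proof.
move=> homD Xki Xki'.
(* Homogeneity covers only those [s] whose sums match the part sizes; for any other [s] the class is
   empty and both counts are 0. *)
have [/forallP sP|/forallPn[j sjP]] :=
  boolP [forall j, \sum_(a : F) s j a == #|X j|]%N; last first.
  have s0 : composition_class D X s = set0.
    apply/setP => u; rewrite !inE.
    apply/negP => /andP[_ /forallP/(_ j)/forallP us].
    case/negP: sjP; rewrite -(sum_ncoord (X j) u).
    by apply/eqP/eq_bigr => a _; rewrite (eqP (us a)).
  by rewrite s0; apply: eq_card => u; rewrite !inE.
(* With one coordinate [p] chosen in [X k], none elsewhere, and color multiset {c}, the design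
   condition reads [u p == c]. *)
pose P j := seq_mset (if j == k then [:: c] else [::]).
have [||lam lamP] := homD s (fun j => eqP (sP j)) (fun j => (j == k) : nat) P.
- by rewrite (bigD1 k) //= eqxx big1 // => j /negPf->.
- by move=> j; rewrite /P (perm_size (perm_eq_seq_mset _)); case: (j == k).
suff cardE p : p \in X k ->
    #|[set u in composition_class D X s | u p == c]| = lam.
  by rewrite !cardE.
move=> Xkp; rewrite -(lamP (single_at k p)) => [|j]; last first.
  rewrite /single_at; case: eqP => [->|_]; last by rewrite sub0set cards0.
  by rewrite sub1set cards1.
apply: eq_card => u; rewrite !inE; congr (_ && _).
have colE j : (colors_on u (single_at k p j) == P j) = (j == k) ==> (u p == c).
  rewrite /colors_on /P /single_at /image_mem; case: (j == k) => /=.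
    rewrite enum_set1 /=; apply/eqP/eqP => [/eq_seq_msetP/perm_mem/(_ c)|->//].
    by rewrite !inE eqxx => /eqP.
  by rewrite enum_set0 /= eqxx.
by apply/idP/forallP => [up j|/(_ k)]; rewrite colE ?eqxx // up implybT.
Qed.

(** Sorting codewords by composition and by the color at the marked coordinate gives classes with
    constant summand, whose sizes do not depend on that coordinate by [homogeneous_card]. *)
Lemma SCJ_homogeneous D i i' :
  generalized_colorwise_homogeneous 1 D X -> i \in X k -> i' \in X k ->
  SCJ D X (single_at k i) = SCJ D X (single_at k i').
Proof.
move=> homD Xki Xki'.
(* Compositions are stored in a finite type so that they can index a sum; counts are at most [#|I|],
   so [inord] keeps their values. *)
pose comp u : {ffun 'I_l -> {ffun F -> 'I_#|I|.+1}} :=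
  [ffun j => [ffun a => inord (ncoord a (X j) u)]].
pose nat_comp (t : {ffun 'I_l -> {ffun F -> 'I_#|I|.+1}}) j a : nat := t j a.
have compE u t : (comp u == t) = [forall j, forall a, ncoord a (X j) u == nat_comp t j a].
  have valE j a : comp u j a = ncoord a (X j) u :> nat.
    by rewrite !ffunE inordK // ltnS max_card.
  apply/eqP/forallP => [<- j|tP].
    by apply/forallP => a; rewrite /nat_comp valE.
  apply/ffunP => j; apply/ffunP => a; apply/val_inj.
  by rewrite /= valE (eqP (forallP (tP j) a)).
(* For u i = c with i in X k, deleting i lowers only the multiplicity of c in X k,
   so the summand of u in SCJ depends only on c and the composition of u. *)
pose term c t : split_poly F l :=
  xvar k c * \prod_j \prod_a yvar j a ^+ (nat_comp t j a - ((j == k) && (c == a))).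
suff SCJE p : p \in X k -> SCJ D X (single_at k p)
    = \sum_t \sum_c term c t *+ #|[set u in composition_class D X (nat_comp t) | u p == c]|.
  rewrite !SCJE //; apply: eq_bigr => t _; apply: eq_bigr => c _.
  by rewrite (homogeneous_card _ _ homD Xki Xki').
move=> Xkp; rewrite SCJ_single_at // (partition_big comp xpredT) //=.
apply: eq_bigr => t _; rewrite (partition_big (fun u => u p) xpredT) //=.
apply: eq_bigr => c _; rewrite -sumr_const.
apply: eq_big => [u|u /andP[/andP[_]]]; first by rewrite !inE compE.
rewrite compE => /forallP ut /eqP <-; congr (_ * _); apply: eq_bigr => j _.
rewrite -prod_ncoord; apply: eq_bigr => a _; congr (_ ^+ _).
rewrite -(eqP (forallP (ut j) a)); case: eqP => [->|/eqP neq_jk].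
  by rewrite ncoordD1.
by rewrite -(setD_single_at j Xkp) /single_at (negPf neq_jk) setD0 subn0.
Qed.

End Disjoint.

End Enumerators.

Theorem theorem4p3 (F : finFieldType) (n l : nat) (C : linear_code n F)
    (v : 'I_l -> nat) (hv : (\sum_(j < l) v j = n)%N)
    (X : 'I_l -> {set 'I_n})
    (hdisj : forall j j' : 'I_l, j != j' -> [disjoint X j & X j'])
    (hcover : \bigcup_(j < l) X j = [set: 'I_n])
    (hcard : forall j, #|X j| = v j)
    (k : 'I_l) (hk : X k != set0) :
  [/\ forall i : 'I_n, i \in X k ->
        SCJ (codewords C) X (single_at k i)
        = xvar k 0 * scwe (code_shorten (codewords C) i) (delete_parts X i)
          + \sum_(a : F | a != 0)
              xvar k a * scwe (code_at (codewords C) i a) (delete_parts X i),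
      (forall u : {ffun 'I_n -> F},
          u \in codewords C -> u != [ffun=> 0] ->
          ~~ (hamming_weight u < 1)%N) ->
        (v k)%:R *: polarize v k (scwe (codewords C) X)
        = xvar k 0 * (\sum_(i in X k)
              scwe (code_shorten (codewords C) i) (delete_parts X i))
          + \sum_(a : F | a != 0)
              xvar k a * (\sum_(i in X k)
                scwe (code_at (codewords C) i a) (delete_parts X i))
    & generalized_colorwise_homogeneous 1 (codewords C) X ->
        forall i : 'I_n, i \in X k ->
          SCJ (codewords C) X (single_at k i)
          = polarize v k (scwe (codewords C) X)].
Proof.
have vk_neq0 : (v k)%:R != 0 :> rat.
  by rewrite Num.Theory.pnatr_eq0 -hcard cards_eq0.
have scale_polarize P : (v k)%:R *: polarize v k P = unnormalized_polarize k P.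
  by rewrite /polarize scalerA divff // scale1r.
split.
(* The term at 0 is the shortened code: [code_shorten] is convertible to [code_at] at 0. *)
- by move=> i Xki; rewrite (SCJ_single_atE hdisj) // (bigD1 0).
- move=> _; rewrite scale_polarize (unnormalized_polarize_scwe _ hdisj).
  rewrite (eq_bigr _ (fun i => @SCJ_single_atE _ _ _ _ _ hdisj _ i)) [LHS]exchange_big.
  rewrite (bigD1 0) //= mulr_sumr; congr (_ + _).
  by apply: eq_bigr => a _; rewrite mulr_sumr.
(* After multiplication by v_k, nonzero because [X k] is nonempty, the right side is a sum of v_k
   equal Jacobi polynomials. *)
- move=> homC i Xki; apply: (scalerI vk_neq0).
  rewrite scale_polarize (unnormalized_polarize_scwe _ hdisj).
  rewrite (eq_bigr (fun=> SCJ (codewords C) X (single_at k i))) => [|i' Xki'].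
    by rewrite sumr_const hcard scaler_nat.
  exact: SCJ_homogeneous.
Qed.
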